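(* The following sets are heroic: (1) $\{\overleftrightarrow{K_2}, \overrightarrow{C_3}, \overrightarrow{K_2}+K_1\}$; (2) $\{\overleftrightarrow{K_2}, K_4, P^+(3)\}$.
   Context: Digraphs have no loops and no parallel arcs, but both $xy$ and $yx$ may be arcs. The dichromatic number $\vec\chi(D)$ is the minimum number of colors in a vertex coloring of $D$ in which no color class induces a directed cycle. For a set $\mathcal F$ containing digraphs and possibly undirected graphs, $Forb_{ind}(\mathcal F)$ is the class of digraphs that contain, as an induced subdigraph, neither any digraph in $\mathcal F$ nor any orientation (oriented graph, i.e. at most one arc per pair) of any undirected graph in $\mathcal F$. $\mathcal F$ is heroic if $Forb_{ind}(\mathcal F)$ has bounded dichromatic number. $\overleftrightarrow{K_2}$ is the digon (two vertices, arcs in both directions); $\overrightarrow{C_3}$ is the directed cycle of length $3$; $\overrightarrow{K_2}+K_1$ is the disjoint union of a single arc and an isolated vertex; $K_4$ is the undirected complete graph on $4$ vertices (so all its orientations are forbidden); $P^+(3)$ is the directed path with $3$ arcs ($4$ vertices). *)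

(* Defs.v *)
From HB Require Import structures.
From mathcomp Require Import all_boot.
From mathcomp Require Import boolp.

Set Implicit Arguments.
Unset Strict Implicit.
Unset Printing Implicit Defensive.

Record digraph := Digraph {
  vertex :> finType;
  arc : rel vertex;
  arc_irr : irreflexive arc
}.

Record graph := Graph {
  gvertex :> finType;
  edge : rel gvertex;
  edge_sym : symmetric edge;
  edge_irr : irreflexive edge
}.

(* Directed cycles are nonempty, repetition-free cyclic sequences; those of
   length 1 are ruled out by arc_irr, and those of length 2 are digons. *)
Definition acyclic (D : digraph) (S : {set D}) : Prop :=
  forall c : seq D, c <> [::] -> {subset c <= S} -> ~ ucycle (@arc D) c.

Definition dicoloring (D : digraph) (k : nat) (f : D -> 'I_k) : Prop :=
  forall i : 'I_k, acyclic [set x | f x == i].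

Definition dicolorable (D : digraph) (k : nat) : Prop :=
  exists f : D -> 'I_k, dicoloring f.

Lemma dicolorable_card (D : digraph) : dicolorable D #|D|.
Proof.
exists enum_rank => i [//|x c] _ sub /andP[cyc /= /andP[xNc _]].
case: c => [|y c] in sub cyc xNc *.
  by move: cyc; rewrite /= arc_irr.
have /eqP ex : enum_rank x == i by have := sub x (mem_head _ _); rewrite inE.
have /eqP ey : enum_rank y == i.
  by have := sub y; rewrite !inE eqxx orbT; apply.
have xy : x = y by apply: enum_rank_inj; rewrite ex ey.
by rewrite xy mem_head in xNc.
Qed.

Lemma dicolorable_ex (D : digraph) : exists k, `[< dicolorable D k >].
Proof. by exists #|D|; apply/asboolP/dicolorable_card. Qed.

Definition dichromatic_number (D : digraph) : nat := ex_minn (dicolorable_ex D).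

Definition induced_subdigraph (H D : digraph) : Prop :=
  exists2 f : H -> D, injective f & forall x y, arc (f x) (f y) = arc x y.

Definition oriented (D : digraph) : Prop :=
  forall x y : D, ~~ (arc x y && arc y x).

(* The vertex set of an orientation of G is that of G up to a bijection. *)
Definition orientation (G : graph) (D : digraph) : Prop :=
  oriented D /\
  exists2 h : D -> G, bijective h &
    forall x y, edge (h x) (h y) = arc x y || arc y x.

Inductive forbidden :=
  | Directed of digraph
  | Undirected of graph.

Definition contains (D : digraph) (F : forbidden) : Prop :=
  match F with
  | Directed H => induced_subdigraph H D
  | Undirected G => exists2 H, orientation G H & induced_subdigraph H D
  end.

(* Plain predicates: the classical_sets type set lives in too small a universe
   to range over digraph. *)
Definition family := forbidden -> Prop.

Definition family3 (A B C : forbidden) : family :=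
  fun X => [\/ X = A, X = B | X = C].

Definition Forb_ind (F : family) (D : digraph) : Prop :=
  forall X, F X -> ~ contains D X.

Definition heroic (F : family) : Prop :=
  exists c : nat, forall D, Forb_ind F D -> dichromatic_number D <= c.

Definition complete_rel (n : nat) : rel 'I_n := fun x y => x != y.

Lemma complete_rel_sym n : symmetric (@complete_rel n).
Proof. by move=> x y; rewrite /complete_rel eq_sym. Qed.

Lemma complete_rel_irr n : irreflexive (@complete_rel n).
Proof. by move=> x; rewrite /complete_rel eqxx. Qed.

Definition complete_graph (n : nat) : graph :=
  Graph (@complete_rel_sym n) (@complete_rel_irr n).

Definition digon : digraph := Digraph (@complete_rel_irr 2).

Definition C3_rel : rel 'I_3 := fun x y => y == ordS x.

Lemma C3_rel_irr : irreflexive C3_rel.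
Proof. by case=> [[|[|[|]]]]. Qed.

Definition directed_C3 : digraph := Digraph C3_rel_irr.

Definition dipath_rel (n : nat) : rel 'I_n.+1 := fun x y => y == x.+1 :> nat.

Lemma dipath_rel_irr n : irreflexive (@dipath_rel n).
Proof. by move=> x; rewrite /dipath_rel ltn_eqF. Qed.

(* n counts the arcs: dipath n has n.+1 vertices. *)
Definition dipath (n : nat) : digraph := Digraph (@dipath_rel_irr n).

Definition disjoint_union_rel (D1 D2 : digraph) : rel (D1 + D2)%type :=
  fun u v =>
    match u, v with
    | inl x, inl y => arc x y
    | inr x, inr y => arc x y
    | _, _ => false
    end.

Lemma disjoint_union_rel_irr (D1 D2 : digraph) :
  irreflexive (@disjoint_union_rel D1 D2).
Proof. by case=> x /=; rewrite arc_irr. Qed.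

Definition disjoint_union (D1 D2 : digraph) : digraph :=
  Digraph (@disjoint_union_rel_irr D1 D2).

Definition single_arc : digraph := dipath 1.

Definition single_vertex : digraph := dipath 0.

(* Main.v *)
(** (1) Without an induced [K2 + K1], non-adjacency is an equivalence relation,
    so the digraph is an orientation of a complete multipartite graph.  If it
    has no directed triangle, then no strong component contains a transitive
    triangle either: following a path from the sink of the triangle back to its
    source, one finds another transitive triangle with a shorter return path.
    Hence every strong component meets at most two parts and two colours suffice.

    (2) Call [S] nice in [V] when each vertex of [S] lacks out-neighbours or
    lacks in-neighbours in [V \ S].  If every nonempty subset of [V] has a
    nonempty nice subset that is [c]-dicolourable, then [V] is
    [2c]-dicolourable.  In a digraph without induced [P+(3)] whose
    neighbourhoods are [c]-dicolourable, a vertex together with its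
    neighbourhood, second out-neighbourhood and second in-neighbourhood is nice
    when there is no directed triangle; and if [C] is a directed triangle and [X]
    the set of vertices having both an in- and an out-neighbour in [C], then
    [N(C)] together with [N(X)] is nice when there is no [K4].  These sets are
    themselves dicolourable with a number of colours linear in [c].  The
    argument is run twice, first inside neighbourhoods, which are
    triangle-free, and then on the whole digraph. *)

From mathcomp Require Import all_boot.
From mathcomp Require Import boolp zify.
Require Import Defs.

Set Implicit Arguments.
Unset Strict Implicit.
Unset Printing Implicit Defensive.

Section Digraph.
Variable D : digraph.
Implicit Types (x y z u v : D) (A B S V : {set D}).

(** * Adjacency and acyclic colourings of vertex sets *)

Definition adj x y := arc x y || arc y x.

Lemma adjC x y : adj x y = adj y x.
Proof. by rewrite /adj orbC. Qed.

Lemma arc_adj x y : arc x y -> adj x y.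
Proof. by rewrite /adj => ->. Qed.

Lemma arc_adjr x y : arc x y -> adj y x.
Proof. by rewrite /adj => ->; rewrite orbT. Qed.

Lemma adjxx x : adj x x = false.
Proof. by rewrite /adj arc_irr. Qed.

(** Colours are natural numbers, so that palettes can be shifted and colourings glued; values of [f]
    outside [A] are irrelevant. *)
Definition setcolorable A (k : nat) : Prop :=
  exists2 f : D -> nat, {in A, forall x, f x < k} &
    forall i, acyclic [set x in A | f x == i].

Lemma dichromatic_number_le (k : nat) :
  setcolorable setT k -> dichromatic_number D <= k.
Proof.
case=> f fk facyc; rewrite /dichromatic_number; case: ex_minnP => m _; apply.
apply/asboolP; exists (fun x => Ordinal (fk x (in_setT x))) => i c c0 cs.
by apply: (facyc i c c0) => x /cs; rewrite !inE.
Qed.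

Lemma setcolorableS A B k : A \subset B -> setcolorable B k -> setcolorable A k.
Proof.
move=> /subsetP AB [f fk fa]; exists f => [x /AB /fk //|i c c0 cs].
by apply: (fa i c c0) => x /cs; rewrite !inE => /andP[/AB-> ->].
Qed.

Lemma setcolorableU A B j k :
  setcolorable A j -> setcolorable B k -> setcolorable (A :|: B) (j + k).
Proof.
move=> [f fj fa] [g gk ga].
exists (fun x => if x \in A then f x else j + g x) => [x|i c c0 cs].
  rewrite inE; case: ifPn => [xA _|_ /= xB]; first by have := fj x xA; lia.
  by have := gk x xB; lia.
have [ij|ij] := ltnP i j.
  apply: (fa i c c0) => x /cs; rewrite !inE; case: ifPn => //= _ /andP[_].
  by move=> /eqP ?; lia.
apply: (ga (i - j) c c0) => x /cs; rewrite !inE.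
case: ifPn => /= [xA /eqP E|_ /andP[-> /eqP <-]]; first by have := fj x xA; lia.
by rewrite addKn /=.
Qed.

Lemma setcolorable_stable A :
  {in A &, forall x y, ~~ arc x y} -> setcolorable A 1.
Proof.
move=> st; exists (fun=> 0) => // i [//|x c] _ cs /andP[/= cyc _].
have inA y : y \in x :: c -> y \in A by move=> /cs; rewrite inE => /andP[].
case: c cyc {cs} inA => [|y c] /= + inA; first by rewrite arc_irr.
by move=> /andP[xy _]; move: xy; apply/negP/st; apply: inA; rewrite !inE eqxx ?orbT.
Qed.

Lemma path_crossing (P : pred D) x (p : seq D) y :
    path (@arc D) x p -> y \in p -> P x -> ~~ P y ->
  exists u v, [/\ u \in x :: p, v \in x :: p, arc u v, P u & ~~ P v].
Proof.
elim: p x => [//|w p IH] x /= /andP[xw wp] yp Px nPy.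
have [Pw|nPw] := boolP (P w); last by exists x, w; rewrite !inE !eqxx orbT.
have yp' : y \in p.
  by move: yp; rewrite inE => /orP[/eqP yw|//]; rewrite yw Pw in nPy.
have [u [v [uw vw uv Pu nPv]]] := IH w wp yp' Pw nPy.
by exists u, v; split; rewrite // inE ?uw ?vw orbT.
Qed.

Lemma cycle_crossing (P : pred D) (c : seq D) x y :
    cycle (@arc D) c -> x \in c -> y \in c -> P x -> ~~ P y ->
  exists u v, [/\ u \in c, v \in c, arc u v, P u & ~~ P v].
Proof.
move=> cyc /rot_to[i c' E] yc Px nPy.
move: cyc; rewrite -(rot_cycle i) E /= => cyc.
have mE z : (z \in c) = (z \in x :: c') by rewrite -E mem_rot.
have yc' : y \in rcons c' x by rewrite mem_rcons -mE.
have [u [v [uc vc uv Pu nPv]]] := path_crossing cyc yc' Px nPy.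
exists u, v; split=> //; rewrite mE.
  by move: uc; rewrite !inE mem_rcons inE orbA orbb.
by move: vc; rewrite !inE mem_rcons inE orbA orbb.
Qed.

(** * Nice sets *)

Definition nice S V : Prop :=
  {in S, forall x, {in V :\: S, forall y, ~~ arc x y} \/
                   {in V :\: S, forall y, ~~ arc y x}}.

(** Peel off [S] and colour [A :\: S] by induction. Vertices of [S] with no in-neighbour in the rest
    use colours below [c], the others a copy shifted by [c]. A monochromatic cycle meeting both [S]
    and the rest has an arc leaving [S] and an arc entering it, which a single type of vertex cannot
    provide. *)
Lemma setcolorable_nice c A :
    (forall V, V \subset A -> V != set0 ->
       exists S, [/\ S \subset V, S != set0, nice S V & setcolorable S c]) ->
  setcolorable A c.*2.
Proof.
have [n] := ubnP #|A|; elim: n A => [//|n IH] A; rewrite ltnS => An niceA.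
have [->|A0] := eqVneq A set0.
  by exists (fun=> 0) => [x|i [//|x s] _ /(_ x (mem_head _ _))]; rewrite !inE.
have [S [SA S0 nS [g gc ga]]] := niceA A (subxx A) A0.
have [|V VA V0|f fc fa] := IH (A :\: S).
- apply: leq_trans An; rewrite cardsD (setIidPr SA).
  have := subset_leq_card SA; have : 0 < #|S| by rewrite card_gt0.
  lia.
- by apply: niceA V0; apply: subset_trans VA (subsetDl _ _).
pose noin x := [forall y in A :\: S, ~~ arc y x].
have noinN x y : x \in S -> ~~ noin x -> y \in A :\: S -> ~~ arc x y.
  move=> xS nx yA; case: (nS x xS) => [|no]; first exact.
  by case/negP: nx; apply/forall_inP.
pose h x := if x \in S then if noin x then g x else c + g x else f x.
exists h => [x xA|i s s0 ss /andP[cyc us]].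
  rewrite /h; case: ifPn => [xS|xS]; last by apply: fc; rewrite inE xS.
  by have := gc x xS; case: ifP => _; lia.
have inA x : x \in s -> x \in A by move=> /ss; rewrite inE => /andP[].
have hi x : x \in s -> h x = i by move=> /ss; rewrite inE => /andP[_ /eqP].
(* As [g] stays below [c] on [S], the colour alone reveals the type of a vertex of [S]. *)
have noin_i x : x \in s -> x \in S -> noin x = (i < c).
  move=> xs xS; rewrite -(hi x xs) /h xS.
  by have := gc x xS; case: ifP => _; lia.
have ucs : ucycle (@arc D) s by apply/andP.
have [/hasP[x xs xS]|/hasPn sS] := boolP (has (mem S) s); last first.
  apply: (fa i s s0) ucs => x xs.
  have xS : x \notin S := sS x xs.
  by rewrite !inE xS inA //= -(hi x xs) /h (negbTE xS).
have [/allP sS|/allPn[y ys yS]] := boolP (all (mem S) s).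
  apply: (ga (if i < c then i else i - c) s s0) ucs => z zs.
  rewrite inE (sS z zs : z \in S) /= -(noin_i z zs (sS z zs)).
  rewrite -(hi z zs) /h (sS z zs : z \in S); case: (noin z) => //.
  by rewrite addKn.
have [u [v [us' vs uv uS vS]]] := cycle_crossing cyc xs ys xS yS.
have [|v' [u' [vs' us'' vu vS' uS']]] :=
  cycle_crossing (P := predC (mem S)) cyc ys xs yS.
  by rewrite /= negbK.
rewrite /= negbK in uS'; rewrite /= in vS'.
have nu : noin u.
  apply: contraLR uv => nu; apply: noinN => //.
  by rewrite inE inA // andbT.
have : noin u' by rewrite noin_i // -(noin_i u us' uS).
move=> /forall_inP /(_ v'); rewrite inE inA // andbT vS' => /(_ isT).
by rewrite vu.
Qed.

(** * Digraphs without an induced path with three arcs *)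

Definition nbhd v := [set y | adj v y].

Definition C3_free V :=
  {in V & &, forall x y z, arc x y -> arc y z -> ~~ arc z x}.

(** The disjuncts are the possible chords of a walk with three arcs. Without digons, a chordless
    walk has distinct vertices and is an induced path. *)
Definition dipath3_free :=
  forall w x y z, arc w x -> arc x y -> arc y z ->
    [|| adj w y, adj x z | adj w z].

Definition K4_free V :=
  forall w x y z, [/\ w \in V, x \in V, y \in V & z \in V] ->
    adj w x -> adj w y -> adj w z -> adj x y -> adj x z -> ~~ adj y z.

Definition out2 V v :=
  [set y in V | ~~ adj v y & [exists u in V, arc v u && arc u y]].

Definition in2 V v :=
  [set y in V | ~~ adj v y & [exists u in V, arc u v && arc y u]].

(** The path [v, u, x, y] has only the chord [u y] left, and [arc y u] would close a directed
    triangle. So a walk from [x] through non-neighbours of [v] stays among the out-neighbours of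
    [u]. *)
Lemma out2_closed V v u x y :
    dipath3_free -> C3_free V -> u \in V -> x \in V -> y \in V ->
    arc v u -> arc u x -> ~~ adj v x -> arc x y -> ~~ adj v y -> arc u y.
Proof.
move=> p3 c3 uV xV yV vu ux nvx xy nvy.
have := p3 _ _ _ _ vu ux xy; rewrite (negbTE nvx) (negbTE nvy) orbF /=.
by case/orP=> // yu; have := c3 _ _ _ uV xV yV ux xy; rewrite yu.
Qed.

Lemma in2_closed V v u x y :
    dipath3_free -> C3_free V -> u \in V -> x \in V -> y \in V ->
    arc u v -> arc x u -> ~~ adj v x -> arc y x -> ~~ adj v y -> arc y u.
Proof.
move=> p3 c3 uV xV yV uv xu nvx yx nvy.
have := p3 _ _ _ _ yx xu uv; rewrite ![adj _ v]adjC.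
rewrite (negbTE nvx) (negbTE nvy) !orbF.
by case/orP=> // uy; have := c3 _ _ _ yV xV uV yx xu; rewrite uy.
Qed.

(** By [out2_closed], the out-neighbours in [W] of one intermediate vertex [u] send no arc to the
    rest of [W]; lying in [nbhd u], they cost [c] colours. *)
Lemma setcolorable_out2 V v c :
    dipath3_free -> C3_free V ->
    {in V, forall u, setcolorable (nbhd u :&: V) c} ->
  setcolorable (out2 V v) c.*2.
Proof.
move=> p3 c3 colN; apply: setcolorable_nice => W /subsetP WV /set0Pn[y yW].
have := WV y yW; rewrite inE => /and3P[yV nvy /exists_inP[u uV /andP[vu uy]]].
exists [set x in W | arc u x]; split.
- by apply/subsetP => x; rewrite inE => /andP[].
- by apply/set0Pn; exists y; rewrite inE yW.
- move=> x; rewrite inE => /andP[xW ux]; left=> z; rewrite !inE => /andP[+ zW].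
  rewrite zW /=; apply: contraNN => xz.
  have := WV x xW; have := WV z zW; rewrite !inE => /and3P[zV nvz _] /and3P[xV nvx _].
  exact: (out2_closed p3 c3 uV xV zV vu ux nvx xz nvz).
- apply: setcolorableS (colN u uV); apply/subsetP => x; rewrite !inE => /andP[xW ux].
  by rewrite arc_adj //; have := WV x xW; rewrite inE => /andP[].
Qed.

Lemma setcolorable_in2 V v c :
    dipath3_free -> C3_free V ->
    {in V, forall u, setcolorable (nbhd u :&: V) c} ->
  setcolorable (in2 V v) c.*2.
Proof.
move=> p3 c3 colN; apply: setcolorable_nice => W /subsetP WV /set0Pn[y yW].
have := WV y yW; rewrite inE => /and3P[yV nvy /exists_inP[u uV /andP[uv yu]]].
exists [set x in W | arc x u]; split.
- by apply/subsetP => x; rewrite inE => /andP[].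
- by apply/set0Pn; exists y; rewrite inE yW.
- move=> x; rewrite inE => /andP[xW xu]; right=> z; rewrite !inE => /andP[+ zW].
  rewrite zW /=; apply: contraNN => zx.
  have := WV x xW; have := WV z zW; rewrite !inE => /and3P[zV nvz _] /and3P[xV nvx _].
  exact: (in2_closed p3 c3 uV xV zV uv xu nvx zx nvz).
- apply: setcolorableS (colN u uV); apply/subsetP => x; rewrite !inE => /andP[xW xu].
  by rewrite arc_adjr //; have := WV x xW; rewrite inE => /andP[].
Qed.

Lemma exists_nice_C3_free V c :
    dipath3_free -> C3_free V -> V != set0 ->
    {in V, forall u, setcolorable (nbhd u :&: V) c} ->
  exists S, [/\ S \subset V, S != set0, nice S V & setcolorable S (1 + 5 * c)].
Proof.
move=> p3 c3 /set0Pn[v vV] colN.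
pose S := [set v] :|: ((nbhd v :&: V) :|: (out2 V v :|: in2 V v)).
exists S; split.
- rewrite !subUset sub1set vV subsetIr /=; apply/andP.
  by split; apply/subsetP => x; rewrite inE => /andP[].
- by apply/set0Pn; exists v; rewrite !inE eqxx.
- have notS z : z \in V :\: S -> [/\ z \in V, ~~ adj v z, z \notin out2 V v & z \notin in2 V v].
    rewrite in_setD !in_setU !negb_or => /andP[/and4P[_ + ? ?] zV].
    by rewrite in_setI zV andbT inE => nvz; split; rewrite // -negb_or.
  move=> x; rewrite /S !in_setU in_set1 in_setI /nbhd inE.
  case/or3P=> [/eqP->|/andP[/orP[vx|xv] xV]|/orP[]].
  + by left=> z /notS[_ + _ _]; apply: contraNN => /arc_adj.
  + left=> z /notS[zV nvz + _]; apply: contraNN => xz; rewrite inE zV nvz /=.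
    by apply/exists_inP; exists x; rewrite ?vx.
  + right=> z /notS[zV nvz _]; apply: contraNN => zx; rewrite inE zV nvz /=.
    by apply/exists_inP; exists x; rewrite ?xv.
  + rewrite inE => /and3P[xV nvx /exists_inP[u uV /andP[vu ux]]].
    left=> z /notS[zV nvz + _]; apply: contraNN => xz; rewrite inE zV nvz /=.
    apply/exists_inP; exists u => //; rewrite vu.
    exact: (out2_closed p3 c3 uV xV zV vu ux nvx xz nvz).
  + rewrite inE => /and3P[xV nvx /exists_inP[u uV /andP[uv xu]]].
    right=> z /notS[zV nvz _]; apply: contraNN => zx; rewrite inE zV nvz /=.
    apply/exists_inP; exists u => //; rewrite uv.
    exact: (in2_closed p3 c3 uV xV zV uv xu nvx zx nvz).
(* One colour for [v], [c] for its neighbourhood, [2c] for each second neighbourhood. *)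
- have -> : 1 + 5 * c = 1 + (c + (c.*2 + c.*2)) by lia.
  apply: setcolorableU.
    by apply: setcolorable_stable => x y /set1P-> /set1P->; rewrite arc_irr.
  apply: setcolorableU; first exact: colN.
  by apply: setcolorableU; [apply: setcolorable_out2|apply: setcolorable_in2].
Qed.

(** A vertex of [N(C)] outside [X] is joined to the triangle [C] in one direction only. If it had
    arcs both from and to vertices outside the set, the absence of induced paths would spread its
    adjacency around [C] and create a [K4]. Vertices of [X] have no neighbour outside, and those of
    [Y] are controlled by their neighbour in [X]. *)
Lemma exists_nice_C3 V c a0 a1 a2 :
    dipath3_free -> K4_free V ->
    a0 \in V -> a1 \in V -> a2 \in V -> arc a0 a1 -> arc a1 a2 -> arc a2 a0 ->
    {in V, forall u, setcolorable (nbhd u :&: V) c} ->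
  exists S, [/\ S \subset V, S != set0, nice S V & setcolorable S (5 * c)].
Proof.
move=> p3 k4 V0 V1 V2 a01 a12 a20 colN.
pose C := [set a0; a1; a2].
pose X := [set x in V | [exists a in C, arc a x] & [exists a in C, arc x a]].
pose NC := (nbhd a0 :&: V) :|: ((nbhd a1 :&: V) :|: (nbhd a2 :&: V)).
pose Y := [set y in V | y \notin NC & [exists x in X, adj x y]].
have NCP y a : y \in V -> y \notin NC -> a \in C -> ~~ adj a y.
  move=> yV; rewrite !inE yV !andbT => yN aC; apply: contraNN yN.
  by case/orP: aC => [/orP[]|] /eqP-> ->; rewrite ?orbT.
have C0 : a0 \in C by rewrite !inE eqxx.
have C1 : a1 \in C by rewrite !inE eqxx orbT.
have C2 : a2 \in C by rewrite !inE eqxx orbT.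
(* Next to a vertex of [X], walking away from it traps the walk in [N(x)]. *)
have Xout x y z : x \in X -> y \in V -> z \in V -> y \notin NC -> z \notin NC ->
    arc x y -> arc y z -> adj x z.
  rewrite inE => /and3P[xV /exists_inP[a aC ax] _] yV zV yN zN xy yz.
  have := p3 _ _ _ _ ax xy yz.
  by rewrite (negbTE (NCP y a yV yN aC)) (negbTE (NCP z a zV zN aC)) orbF.
have Xin x y z : x \in X -> y \in V -> z \in V -> y \notin NC -> z \notin NC ->
    arc y x -> arc z y -> adj x z.
  rewrite inE => /and3P[xV _ /exists_inP[a aC xa]] yV zV yN zN yx zy.
  have := p3 _ _ _ _ zy yx xa; rewrite ![adj _ a]adjC.
  by rewrite (negbTE (NCP y a yV yN aC)) (negbTE (NCP z a zV zN aC)) !orbF [adj x z]adjC.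
exists (NC :|: Y); split.
- rewrite !subUset !subsetIr /=.
  by apply/subsetP => x; rewrite inE => /andP[].
- by apply/set0Pn; exists a0; rewrite !inE V0 (arc_adjr a01) /= !orbT.
- have notS z : z \in V :\: (NC :|: Y) -> [/\ z \in V, z \notin NC & z \notin Y].
    by rewrite in_setD in_setU negb_or => /andP[/andP[]].
  have XY x z : x \in X -> z \in V :\: (NC :|: Y) -> ~~ adj x z.
    move=> xX /notS[zV zN]; apply: contraNN => xz.
    by rewrite inE zV zN; apply/exists_inP; exists x.
  move=> x; rewrite in_setU => /orP[xN|]; last first.
    rewrite inE => /and3P[xV xN /exists_inP[w wX /orP[wx|xw]]].
      left=> z zS; have [zV zN _] := notS z zS.
      apply: contraNN (XY w z wX zS); exact: (Xout w x z).
    right=> z zS; have [zV zN _] := notS z zS.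
    apply: contraNN (XY w z wX zS); exact: (Xin w x z).
  have xV : x \in V by move: xN; rewrite !inE -!andb_orl => /andP[].
  have [xX|xX] := boolP (x \in X).
    by left=> z /(XY x z xX); apply: contraNN => /arc_adj.
  have k4x : adj x a0 -> adj x a1 -> ~~ adj x a2.
    move=> x0 x1; apply/negP => x2; have /negP := k4 x a0 a1 a2 (And4 xV V0 V1 V2)
      x0 x1 x2 (arc_adj a01) (arc_adjr a20); by rewrite arc_adj.
  have [/exists_inP[a aC ax]|nin] := boolP [exists a in C, arc a x].
    have nout a' : a' \in C -> arc x a' = false.
      move=> aC'; apply/negP => xa; case/negP: xX; rewrite inE xV /=.
      by apply/andP; split; apply/exists_inP; [exists a|exists a'].
    left=> z /notS[zV zN _]; apply/negP => xz.
    (* In the path [b', b, x, z] the vertex [z] is adjacent to neither [b] nor [b'], so [b'] and [x]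
       are adjacent; this moves backwards around the triangle. *)
    have step b b' : b \in C -> b' \in C -> arc b' b -> arc b x -> arc b' x.
      move=> bC bC' bb bx; have := p3 _ _ _ _ bb bx xz.
      rewrite (negbTE (NCP z b zV zN bC)) (negbTE (NCP z b' zV zN bC')) !orbF.
      by rewrite /adj (nout b') ?orbF.
    have [x0 x1 x2] : [/\ arc a0 x, arc a1 x & arc a2 x].
      have s0 := step a1 a0 C1 C0 a01; have s1 := step a2 a1 C2 C1 a12.
      have s2 := step a0 a2 C0 C2 a20.
      move: aC ax; rewrite !inE => /orP[/orP[]|] /eqP-> ax.
      - by split; auto.
      - by split; auto.
      - by split; auto.
    by have := k4x (arc_adjr x0) (arc_adjr x1); rewrite (arc_adjr x2).
  have {}nin a : a \in C -> arc a x = false.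
    by move=> aC; apply/negP => ax; case/negP: nin; apply/exists_inP; exists a.
  have [a aC xa] : exists2 a, a \in C & arc x a.
    move: xN; rewrite !inE xV !andbT /adj.
    by case/or3P; rewrite nin //= => ?; [exists a0|exists a1|exists a2].
  right=> z /notS[zV zN _]; apply/negP => zx.
  (* Mirror image: the path [z, x, b, b'] moves forwards around the triangle. *)
  have step b b' : b \in C -> b' \in C -> arc b b' -> arc x b -> arc x b'.
    move=> bC bC' bb xb; have := p3 _ _ _ _ zx xb bb.
    rewrite ![adj z _]adjC (negbTE (NCP z b zV zN bC)) (negbTE (NCP z b' zV zN bC')).
    by rewrite orbF /adj (nin b') ?orbF.
  have [x0 x1 x2] : [/\ arc x a0, arc x a1 & arc x a2].
    have s0 := step a0 a1 C0 C1 a01; have s1 := step a1 a2 C1 C2 a12.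
    have s2 := step a2 a0 C2 C0 a20.
    move: aC xa; rewrite !inE => /orP[/orP[]|] /eqP-> xa.
    - by split; auto.
    - by split; auto.
    - by split; auto.
  by have := k4x (arc_adj x0) (arc_adj x1); rewrite (arc_adj x2).
(* [c] colours for each of the three neighbourhoods in [NC], and [2c] for [Y], peeled off by the
   nice sets [nbhd x :&: W] with [x] in [X]. *)
have -> : 5 * c = (c + (c + c)) + c.*2 by lia.
apply: setcolorableU.
  by do 2?[apply: setcolorableU]; apply: colN.
apply: setcolorable_nice => W /subsetP WY /set0Pn[y yW].
have := WY y yW; rewrite inE => /and3P[yV yN /exists_inP[x xX xy]].
exists (nbhd x :&: W); split.
- exact: subsetIr.
- by apply/set0Pn; exists y; rewrite !inE xy.
- move=> u; rewrite in_setI inE => /andP[xu uW].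
  have := WY u uW; rewrite inE => /and3P[uV uN _].
  case/orP: xu => [xu|ux]; [left|right] => z; rewrite in_setD in_setI;
    rewrite /nbhd inE => /andP[+ zW]; rewrite zW andbT; apply: contraNN => uz;
    have := WY z zW; rewrite inE => /and3P[zV zN _].
    exact: (Xout x u z).
  exact: (Xin x u z).
- apply: setcolorableS (colN x _); last by move: xX; rewrite inE => /andP[].
  apply/subsetP => u; rewrite !inE => /andP[-> /WY].
  by rewrite inE => /andP[].
Qed.

Lemma setcolorable_of_nbhd V c :
    dipath3_free -> K4_free V ->
    {in V, forall u, setcolorable (nbhd u :&: V) c} ->
  setcolorable V (1 + 5 * c).*2.
Proof.
move=> p3 k4 colN; apply: setcolorable_nice => W /subsetP WV W0.
have colW : {in W, forall u, setcolorable (nbhd u :&: W) c}.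
  move=> u /WV /colN; apply: setcolorableS; apply: setIS.
  exact/subsetP.
have k4W : K4_free W.
  by move=> w x y z [/WV ? /WV ? /WV ? /WV ?]; apply: k4.
have [c3|] := pselect (C3_free W); first exact: exists_nice_C3_free.
move=> nc3; have [x [y [z [xW yW zW]]]] : exists x y z,
    [/\ x \in W, y \in W, z \in W & [/\ arc x y, arc y z & arc z x]].
  apply: contrapT => no; apply: nc3 => x y z xW yW zW xy yz.
  by apply/negP => zx; apply: no; exists x, y, z.
case=> xy yz zx.
have [S [SW S0 nS cS]] := exists_nice_C3 p3 k4W xW yW zW xy yz zx colW.
exists S; split=> //; case: cS => f fc fa; exists f => // u /fc; lia.
Qed.

(** Two adjacent common neighbours of adjacent [u] and [v] would give a [K4], so inside [nbhd v]
    neighbourhoods are stable and [c = 1]. Then [nbhd v] needs [2(1 + 5) = 12] colours and the whole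
    digraph [2(1 + 5 * 12) = 122]. *)
Theorem setcolorable_K4_free : dipath3_free -> K4_free setT -> setcolorable setT 122.
Proof.
move=> p3 k4; apply: (@setcolorable_of_nbhd setT 12) => // v _.
apply: (@setcolorable_of_nbhd _ 1) => // [w x y z _ *|u].
  by apply: (k4 w x y z) => //; split; rewrite in_setT.
rewrite !inE andbT => vu; apply: setcolorable_stable => x y.
rewrite !inE !andbT => /andP[ux vx] /andP[uy vy].
apply/negP => /arc_adj; apply/negP.
by apply: (k4 v u x y) => //; split; rewrite in_setT.
Qed.

(** * Orientations of complete multipartite graphs without directed triangles *)

Lemma no_transitive_triangle_strong x y z (p : seq D) :
    C3_free setT ->
    (forall u v, arc u v -> ~~ arc v u) ->
    (forall u v w, adj u v -> adj u w || adj v w) ->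
    arc x z -> arc z y -> arc x y -> path (@arc D) y p -> last y p = x ->
  False.
Proof.
move=> c3T nodigon part; have c3 u v w : arc u v -> arc v w -> arc w u -> False.
  by move=> uv vw wu; have := c3T u v w; rewrite wu !inE => /(_ isT isT isT uv vw).
have force u v w : arc u v -> arc v w -> adj u w -> arc u w.
  by move=> uv vw /orP[//|/(c3 _ _ _ uv vw)].
have [n] := ubnP (size p); elim: n x y z p => // n IH x y z [|p1 p] /=.
  by move=> _ _ _ + _ E; rewrite E arc_irr.
rewrite ltnS => pn xz zy xy /andP[yp1 p1p] E.
(* If [x] and [p1] are adjacent, [p1] is the sink of the transitive triangle on [x, y, p1], one step
   further along the return path. *)
have [xp1|nxp1] := boolP (adj x p1).
  by apply: (IH x p1 y p) => //; exact: (force x y p1).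
have zp1 : arc z p1.
  apply: force zy yp1 _; have := part _ _ p1 (arc_adj xz).
  by rewrite (negbTE nxp1).
case: p => [|p2 p] /= in pn p1p E *.
  by rewrite E (negbTE (nodigon _ _ xy)) in yp1.
case/andP: p1p => p12 p2p.
(* If [y] and [p2] are adjacent, the return path can skip [p1]. Otherwise they lie in the same part,
   and [p2] replaces [y] as the sink. *)
have [yp2|nyp2] := boolP (adj y p2).
  by apply: (IH x y z (p2 :: p)) => //=; rewrite (force y p1 p2).
have zp2 : arc z p2.
  apply: force zp1 p12 _; have := part _ _ p2 (arc_adj zy).
  by rewrite (negbTE nyp2) orbF.
have xp2 : arc x p2.
  apply: force xz zp2 _; have := part _ _ p2 (arc_adj xy).
  by rewrite (negbTE nyp2) orbF.
by apply: (IH x p2 z p) => //; apply: ltnW.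
Qed.

Theorem setcolorable_multipartite :
    C3_free setT ->
    (forall u v, arc u v -> ~~ arc v u) ->
    (forall u v w, adj u v -> adj u w || adj v w) ->
  setcolorable setT 2.
Proof.
move=> c3 nodigon part.
pose strong x y := connect (@arc D) x y && connect (@arc D) y x.
have strongC x y : strong x y = strong y x by rewrite /strong andbC.
have strongT x y z : strong x y -> strong y z -> strong x z.
  move=> /andP[xy yx] /andP[yz zy].
  by rewrite /strong (connect_trans xy yz) (connect_trans zy yx).
have notrans x y z : strong x y -> arc x z -> arc z y -> arc x y -> False.
  move=> /andP[_ /connectP[p pp E]] xz zy xy.
  exact: (no_transitive_triangle_strong c3 nodigon part xz zy xy pp).
have noC3 x y z : arc x y -> arc y z -> arc z x -> False.
  by move=> xy yz zx; have := c3 x y z; rewrite zx !inE => /(_ isT isT isT xy yz).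
have notri x y z : strong x y -> strong x z -> adj x y -> adj y z -> adj x z -> False.
  move=> sxy sxz; have syz : strong y z by apply: strongT sxz; rewrite strongC.
  have szx : strong z x by rewrite strongC.
  have szy : strong z y by rewrite strongC.
  have syx : strong y x by rewrite strongC.
  (* Of the eight orientations two are directed triangles and six are transitive. *)
  move=> /orP[xy|yx] /orP[yz|zy] /orP[xz|zx]; eauto.
(* The index of the part of [x]: the position of its first vertex. *)
pose idx x := find (fun y => ~~ adj x y) (enum D).
have idxE x y : (idx x == idx y) = ~~ adj x y.
  apply/eqP/idP => [E|nxy].
    (* Each vertex is its own non-neighbour, so [find] always succeeds. *)
    have hasx u : has (fun y => ~~ adj u y) (enum D).
      by apply/hasP; exists u; rewrite ?mem_enum ?adjxx.
    have := nth_find x (hasx y); have := nth_find x (hasx x).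
    rewrite -/(idx x) -/(idx y) E => nx ny.
    apply/negP => /(part x y (nth x (enum D) (idx y))).
    by rewrite (negbTE nx) (negbTE ny).
  apply: eq_find => w; apply/idP/idP; apply: contraNN.
    by move=> /(part y w x); rewrite ![adj _ x]adjC (negbTE nxy).
  by move=> /(part x w y); rewrite (negbTE nxy) [adj w y]adjC.
(* Colour 0 marks the part of least index met by the strong component of [x], colour 1 all other
   parts. *)
pose f x : nat := [exists w, strong x w && (idx w < idx x)].
exists f => [x _|i [//|x c] _ cs /andP[cyc _]]; first by rewrite /f; case: [exists _, _].
have fi y : y \in x :: c -> f y = i by move=> /cs; rewrite !inE => /eqP.
case: c => [|y c] in cyc cs fi *; first by rewrite /= arc_irr in cyc.
have yin : y \in [:: x, y & c] by rewrite !inE eqxx orbT.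
(* The first arc of the cycle suffices: it joins two vertices of one strong component with the same
   colour. *)
have sxy : strong x y by rewrite /strong !(connect_cycle cyc) ?mem_head.
have xy : adj x y by move: cyc => /= /andP[/arc_adj].
have low u v : strong u v -> adj u v -> f u = f v -> idx u < idx v -> False.
  move=> suv uv E lt; have : f u = 1.
    by rewrite E /f (_ : [exists _, _]) //; apply/existsP; exists u; rewrite strongC suv.
  rewrite /f; case: existsP => // -[w /andP[suw wu]] _.
  (* Here [idx w < idx u < idx v]: three parts in one strong component give a triangle. *)
  apply: (notri u v w) => //; rewrite -[adj _ _]negbK -idxE; lia.
have E : f x = f y by rewrite !fi ?mem_head.
case: (ltngtP (idx x) (idx y)) => [lt|gt|/eqP].
- exact: (low x y).
- by apply: (low y x) gt; rewrite 1?strongC 1?adjC.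
- by rewrite idxE xy.
Qed.

(** * From forbidden induced subdigraphs to conditions on arcs *)

Lemma digon_free_oriented :
  ~ contains D (Directed digon) -> forall u v, arc u v -> ~~ arc v u.
Proof.
move=> no u v uv; apply/negP => vu; apply: no.
have nuv : u != v by apply: contraTneq uv => ->; rewrite arc_irr.
exists (fun i : 'I_2 => if i == ord0 then u else v).
  by case=> [[|[|//]] ?] [[|[|//]] ?] //= E; try exact: val_inj;
    rewrite E eqxx in nuv.
by case=> [[|[|//]] ?] [[|[|//]] ?]; rewrite /= ?arc_irr ?uv ?vu.
Qed.

Lemma C3_freeT : ~ contains D (Directed directed_C3) ->
  (forall u v, arc u v -> ~~ arc v u) -> C3_free setT.
Proof.
move=> no nodigon x y z _ _ _ xy yz; apply/negP => zx; apply: no.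
have ne u v : arc u v -> (u == v) = false.
  by move=> uv; apply: contraTF uv => /eqP ->; rewrite arc_irr.
exists (fun i : 'I_3 => nth x [:: x; y; z] i).
  case=> [[|[|[|//]]] ?] [[|[|[|//]]] ?] //= /eqP; try by move=> _; exact: val_inj.
  - by rewrite ne.
  - by rewrite eq_sym ne.
  - by rewrite eq_sym ne.
  - by rewrite ne.
  - by rewrite ne.
  - by rewrite eq_sym ne.
case=> [[|[|[|//]]] ?] [[|[|[|//]]] ?];
  by rewrite /= ?arc_irr ?xy ?yz ?zx // (negbTE (nodigon _ _ _)).
Qed.

Lemma nonadj_trans :
    ~ contains D (Directed (disjoint_union single_arc single_vertex)) ->
    (forall u v, arc u v -> ~~ arc v u) ->
  forall u v w, adj u v -> adj u w || adj v w.
Proof.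
move=> no nodigon; have main u v w : arc u v -> adj u w || adj v w.
  move=> uv; apply: contrapT => /negP; rewrite negb_or => /andP[uw vw]; apply: no.
  have nuv : (u == v) = false by apply: contraTF uv => /eqP->; rewrite arc_irr.
  have nuw : (u == w) = false by apply: contraNF vw => /eqP<-; rewrite arc_adjr.
  have nvw : (v == w) = false by apply: contraNF uw => /eqP<-; rewrite arc_adj.
  have [nvu nwu nwv] : [/\ (v == u) = false, (w == u) = false & (w == v) = false].
    by split; rewrite eq_sym.
  pose f (i : 'I_2 + 'I_1) :=
    match i with inl j => if j == ord0 then u else v | inr _ => w end.
  exists f.
    by case=> [[[|[|//]] ?]|[[|//] ?]] [[[|[|//]] ?]|[[|//] ?]] /eqP; rewrite /f /=
      ?nuv ?nuw ?nvw ?nvu ?nwu ?nwv // => _; congr (_ _); apply: val_inj.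
  move: uw vw; rewrite /adj !negb_or => /andP[uw wu] /andP[vw wv].
  by case=> [[[|[|//]] ?]|[[|//] ?]] [[[|[|//]] ?]|[[|//] ?]];
    rewrite /f /= ?arc_irr ?uv ?(negbTE (nodigon _ _ uv)) // ?(negbTE uw) ?(negbTE wu)
     ?(negbTE vw) ?(negbTE wv).
move=> u v w /orP[/main //|/main]; by rewrite orbC.
Qed.

Lemma dipath3_freeP : ~ contains D (Directed (dipath 3)) ->
  (forall u v, arc u v -> ~~ arc v u) -> dipath3_free.
Proof.
move=> no nodigon w x y z wx xy yz; apply: contrapT => /negP.
rewrite !negb_or => /and3P[/andP[/negbTE wy /negbTE yw]].
move=> /andP[/negbTE xz /negbTE zx] /andP[/negbTE wz /negbTE zw]; apply: no.
exists (fun i : 'I_4 => nth w [:: w; x; y; z] i); last first.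
  by case=> [[|[|[|[|//]]]] ?] [[|[|[|[|//]]]] ?];
    rewrite /= ?arc_irr ?wx ?xy ?yz ?wy ?yw ?xz ?zx ?wz ?zw
      ?(negbTE (nodigon _ _ wx)) ?(negbTE (nodigon _ _ xy)) ?(negbTE (nodigon _ _ yz)).
have un : uniq [:: w; x; y; z].
  rewrite /= !inE !negb_or !andbT; apply/and3P; split; [apply/and3P; split|apply/andP; split|].
  - by apply: contraTneq wx => ->; rewrite arc_irr.
  - by apply: contraTneq wx => ->; rewrite (negbTE (nodigon _ _ xy)).
  - by apply: contraTneq yz => <-; rewrite yw.
  - by apply: contraTneq xy => ->; rewrite arc_irr.
  - by apply: contraTneq xy => ->; rewrite (negbTE (nodigon _ _ yz)).
  - by apply: contraTneq yz => ->; rewrite arc_irr.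
by move=> i j /eqP; rewrite nth_uniq ?ltn_ord // => /eqP/val_inj.
Qed.

Lemma K4_freeT : ~ contains D (Undirected (complete_graph 4)) ->
  (forall u v, arc u v -> ~~ arc v u) -> K4_free setT.
Proof.
move=> no nodigon w x y z _ wx wy wz xy xz; apply/negP => yz; apply: no.
pose g (i : 'I_4) := nth w [:: w; x; y; z] i.
(* The orientation of [K4] is obtained by pulling the arcs of [D] back along [g]. *)
have girr : irreflexive (fun i j => arc (g i) (g j)) by move=> i; rewrite /= arc_irr.
exists (Digraph girr).
  split; first by move=> i j /=; apply/negP => /andP[/nodigon /negbTE->].
  exists id => [|i j]; first by exists id.
  rewrite -/(adj (g i) (g j)); move: i j.
  by case=> [[|[|[|[|//]]]] ?] [[|[|[|[|//]]]] ?];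
    rewrite /g /= ?adjxx // ?[adj x w]adjC ?[adj y w]adjC ?[adj z w]adjC
     ?[adj y x]adjC ?[adj z x]adjC ?[adj z y]adjC ?wx ?wy ?wz ?xy ?xz ?yz.
have ne u v : adj u v -> u != v by apply: contraTneq => ->; rewrite adjxx.
exists g => // i j /eqP; rewrite /g nth_uniq ?ltn_ord // => [/eqP/val_inj //|].
by rewrite /= !inE !negb_or !ne.
Qed.

End Digraph.

Theorem theorem8 :
  heroic (family3 (Directed digon)
                  (Directed directed_C3)
                  (Directed (disjoint_union single_arc single_vertex))) /\
  heroic (family3 (Directed digon)
                  (Undirected (complete_graph 4))
                  (Directed (dipath 3))).
Proof.
split; [exists 2|exists 122] => D no; apply: dichromatic_number_le;
  have nodigon := digon_free_oriented (no _ (Or31 _ _ erefl)).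
  apply: setcolorable_multipartite (nodigon) _.
    exact: C3_freeT (no _ (Or32 _ _ erefl)) nodigon.
  exact: nonadj_trans (no _ (Or33 _ _ erefl)) nodigon.
apply: setcolorable_K4_free.
  exact: dipath3_freeP (no _ (Or33 _ _ erefl)) nodigon.
exact: K4_freeT (no _ (Or32 _ _ erefl)) nodigon.
Qed.
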